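(* Let $d\ge3$ be an integer, $p_1,\dots,p_d\in(0,1)$, and let $J^d$ be the first rencontre-time of $d$ independent Bernoulli sequences with these parameters (see context). For $0\le x<1$ let $\varphi_d(x)=\sum_{n=1}^\infty P(R^d_n)x^n$ and $\varphi_d(1-)=\lim_{x\to1-}\varphi_d(x)$. Then: in the case $d=3$, if $p_1=p_2=p_3$ then $\varphi_3(1-)=\infty$ and $P(J^3=\infty)=0$ (a rencontre happens almost surely); if $p_1,p_2,p_3$ are not all equal then $\varphi_3(1-)<\infty$ and $P(J^3=\infty)>0$. In the case $d\ge4$, $\varphi_d(1-)<\infty$ regardless of the values of $p_1,\dots,p_d$, and $P(J^d=\infty)>0$.
   Context: Let $d\ge2$ be an integer and $p_1,\dots,p_d\in(0,1)$. Let $\{X^j_k\}_{k\ge1}$, $j=1,\dots,d$, be independent sequences, the $j$-th consisting of i.i.d. Bernoulli random variables with success parameter $p_j$ (all $X^j_k$ mutually independent). Set $S^j(n)=\sum_{i=1}^n X^j_i$. For $n\ge1$, $R^d_n$ denotes the event $\{S^1(n)=S^2(n)=\dots=S^d(n)\}$ (a ''rencontre at time $n$''), and $J^d=\inf\{n\ge1:R^d_n \text{ occurs}\}$ with $\inf\emptyset=\infty$. *)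

(* Defs.v *)
From HB Require Import structures.
From mathcomp Require Import all_boot all_order all_algebra.
From mathcomp Require Import all_classical all_reals all_analysis.
Set Implicit Arguments. Unset Strict Implicit. Unset Printing Implicit Defensive.
Import Order.TTheory GRing.Theory Num.Theory.
Local Open Scope classical_set_scope.
Local Open Scope ring_scope.

Definition mutually_independent (d0 : measure_display) (T : measurableType d0)
  (R : realType) (P : probability T R) (I : eqType) (X : I -> T -> R) : Prop :=
  forall (F : seq I) (B : I -> set R), uniq F ->
    (forall i, measurable (B i)) ->
    P (\big[setI/setT]_(i <- F) (X i @^-1` B i)) =
    (\prod_(i <- F) P (X i @^-1` B i))%E.

(* Convention: X j k is the paper's X^j_{k+1} (k : nat starts at 0),
   so S^j(n) = sum_{k<n} X j k. *)
Definition S (T : Type) (R : realType) (d : nat) (X : 'I_d -> nat -> T -> R)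
  (j : 'I_d) (n : nat) (w : T) : R := \sum_(k < n) X j k w.

Definition rencontre (T : Type) (R : realType) (d : nat)
  (X : 'I_d -> nat -> T -> R) (n : nat) : set T :=
  [set w | forall i j : 'I_d, S X i n w = S X j n w].

(* First rencontre time J^d = inf {n >= 1 : R^d_n}, with inf of empty = +oo. *)
Definition J (T : Type) (R : realType) (d : nat)
  (X : 'I_d -> nat -> T -> R) (w : T) : \bar R :=
  ereal_inf [set (n%:R)%:E | n in [set n : nat | (1 <= n)%N /\ rencontre X n w]].

Definition phi (d0 : measure_display) (T : measurableType d0) (R : realType)
  (P : probability T R) (d : nat) (X : 'I_d -> nat -> T -> R) (x : R) : \bar R :=
  (\sum_(1 <= n <oo) (P (rencontre X n) * (x ^+ n)%:E))%E.

(* Main.v *)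
Require Import Defs.
From HB Require Import structures.
From mathcomp Require Import all_boot all_order all_algebra.
From mathcomp Require Import all_classical all_reals all_analysis.
From mathcomp Require Import ring lra zify.
Import Order.TTheory GRing.Theory Num.Theory.
Import numFieldNormedType.Exports.
Local Open Scope classical_set_scope.
Local Open Scope ring_scope.

(** Let [u n] be the probability of a rencontre at time [n] and [q n] that of no
   rencontre at the times [1..n]. Splitting according to the last rencontre before time
   [N] gives [\sum_(n <= N) u n * q (N - n) = 1], and [q n] tends to [P (J = oo)]; hence
   [P (J = oo) > 0] iff [\sum u n] converges. Here [u n = \sum_k \prod_j b_j(n, k)] with
   [b_j] the binomial mass functions. If [p_i != p_j], keeping only the factors [i] and
   [j] bounds [u n] by the [n]-th power of a Bhattacharyya coefficient smaller than 1.
   If all parameters are equal, [b(n, k) <= C / sqrt n] gives [u n <= (C / sqrt n)^3]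
   for [d >= 4], whereas for [d = 3] the concentration of [b(n, .)] on about [sqrt n]
   values gives [u n >= c / n]. *)

(** * Finite sequences of trials *)

Definition row_weight (R : realFieldType) (d : nat) (p : 'I_d -> R)
  (c : {ffun 'I_d -> bool}) : R := \prod_j (if c j then p j else 1 - p j).

(** Expectation over [n] independent rows, the head of the list being the earliest. As an iterated
    finite sum it permits induction on [n] without measure theory; [history_event] links it to
    [P]. *)
Fixpoint expect (R : realFieldType) (d : nat) (p : 'I_d -> R) (n : nat)
  (F : seq {ffun 'I_d -> bool} -> R) : R :=
  if n is m.+1 then \sum_c row_weight R d p c * expect R d p m (fun s => F (c :: s))
  else F [::].

Arguments row_weight {R d} p c.
Arguments expect {R d} p n F.

Section Expect.
Variables (R : realFieldType) (d : nat) (p : 'I_d -> R).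
Implicit Types (F G : seq {ffun 'I_d -> bool} -> R).

Lemma eq_expect n F G : (forall s, size s = n -> F s = G s) ->
  expect p n F = expect p n G.
Proof.
elim: n F G => [|n IH] F G FG /=; first exact: FG.
by apply: eq_bigr => c _; congr (_ * _); apply: IH => s sn; apply: FG; rewrite /= sn.
Qed.

Lemma expectZ n a F : expect p n (fun s => a * F s) = a * expect p n F.
Proof.
elim: n F => //= n IH F; rewrite mulr_sumr; apply: eq_bigr => c _.
by rewrite IH mulrCA.
Qed.

Lemma expect_sum n (I : Type) (r : seq I) (F : I -> seq _ -> R) :
  expect p n (fun s => \sum_(i <- r) F i s) = \sum_(i <- r) expect p n (F i).
Proof.
elim: n F => //= n IH F; rewrite exchange_big /=; apply: eq_bigr => c _.
by rewrite IH mulr_sumr.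
Qed.

(** Independence of the coordinates within a row: a product of two-term sums expands into a sum over
    all choices. *)
Lemma row_weight_prod (f : 'I_d -> bool -> R) :
  \sum_c row_weight p c * \prod_j f j (c j) =
  \prod_j (p j * f j true + (1 - p j) * f j false).
Proof.
rewrite (eq_bigr (fun j => \sum_b (if b then p j else 1 - p j) * f j b)); last first.
  by move=> j _; rewrite big_bool.
rewrite bigA_distr_bigA /=; apply: eq_bigr => c _.
by rewrite big_split.
Qed.

Lemma expect1 n : expect p n (fun=> 1) = 1.
Proof.
elim: n => //= n ->.
have := row_weight_prod (fun _ _ => 1); rewrite big1_eq => ->.
by rewrite big1 // => j _; rewrite !mulr1 addrC subrK.
Qed.

(** Independence of the first [n] rows from the following [m]. *)
Lemma expect_cat n m F G :
  expect p (n + m) (fun s => F (take n s) * G (drop n s)) =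
  expect p n F * expect p m G.
Proof.
elim: n F => [|n IH] F /=.
  by rewrite -expectZ; apply: eq_expect => s _; rewrite take0 drop0.
rewrite mulr_suml; apply: eq_bigr => c _; rewrite -mulrA; congr (_ * _).
by rewrite (IH (fun s => F (c :: s))).
Qed.

Hypothesis hp : forall j, 0 < p j < 1.

Lemma row_weight_ge0 c : 0 <= row_weight p c.
Proof. by apply: prodr_ge0 => j _; have := hp j; case: (c j); lra. Qed.

Lemma ler_expect n F G : (forall s, size s = n -> F s <= G s) ->
  expect p n F <= expect p n G.
Proof.
elim: n F G => [|n IH] F G FG /=; first exact: FG.
apply: ler_sum => c _; apply: ler_wpM2l; first exact: row_weight_ge0.
by apply: IH => s sn; apply: FG; rewrite /= sn.
Qed.

End Expect.

(** * Rencontres of a finite sequence and the last of them *)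

Definition column_count (d : nat) (s : seq {ffun 'I_d -> bool}) (j : 'I_d) : nat :=
  count (fun c : {ffun _} => c j) s.

Definition level (d : nat) (s : seq {ffun 'I_d -> bool}) : bool :=
  [forall i, forall j, column_count d s i == column_count d s j].

(** The times start at 1, because the empty prefix is always level. *)
Definition never_level (d : nat) (s : seq {ffun 'I_d -> bool}) : bool :=
  all (fun n => ~~ level d (take n s)) (iota 1 (size s)).

Arguments column_count {d} s j.
Arguments level {d} s.
Arguments never_level {d} s.

Lemma column_count_cat d (s t : seq {ffun 'I_d -> bool}) j :
  column_count (s ++ t) j = (column_count s j + column_count t j)%N.
Proof. exact: count_cat. Qed.

(** The renewal property: a level prefix adds the same amount to every column, so the comparison of
    columns starts afresh after it. *)
Lemma level_cat d (s t : seq {ffun 'I_d -> bool}) :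
  level s -> level (s ++ t) = level t.
Proof.
move=> /forallP s0; apply: eq_forallb => i; apply: eq_forallb => j.
rewrite !column_count_cat; have /forallP/(_ j)/eqP -> := s0 i.
by rewrite eqn_add2l.
Qed.

(** The sum counts the indices up to [N] that are last to satisfy [r]; there is one because [r 0]
    holds, and only one. *)
Lemma last_true (r : pred nat) N : r 0%N ->
  (\sum_(n < N.+1) (r n && all (fun m => ~~ r m) (iota n.+1 (N - n))) = 1)%N.
Proof.
move=> r0; elim: N => [|N IH]; first by rewrite big_ord_recr big_ord0 /= r0.
rewrite big_ord_recr /= subnn /= andbT.
(* If [r N.+1] holds, no earlier index is last; otherwise the last index up to [N] remains last. *)
case: (boolP (r N.+1)) => rN.
- rewrite big1 // => n _; apply/eqP; rewrite eqb0.
  apply/negP => /andP[_ /allP/(_ N.+1)]; rewrite rN mem_iota.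
  by have := ltn_ord n; lia.
- rewrite addn0 -[RHS]IH; apply: eq_bigr => n _; congr (nat_of_bool (_ && _)).
  have nN := ltn_ord n.
  have -> : (N.+1 - n = (N - n) + 1)%N by lia.
  rewrite iotaD all_cat /=.
  have -> : (n.+1 + (N - n) = N.+1)%N by lia.
  by rewrite rN !andbT.
Qed.

Lemma last_level d N (s : seq {ffun 'I_d -> bool}) : size s = N ->
  (\sum_(n < N.+1) (level (take n s) && never_level (drop n s)) = 1)%N.
Proof.
move=> sN; rewrite -[RHS](last_true (fun n => level (take n s)) N); last first.
  by rewrite take0; apply/forallP => i; apply/forallP => j.
apply: eq_bigr => n _; case: (boolP (level (take n s))) => //= sn.
congr nat_of_bool; rewrite /never_level size_drop sN -[n.+1]addn1 iotaDl all_map.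
apply: eq_in_all => m /=; rewrite mem_iota => /andP[m0 mN].
by rewrite takeD level_cat.
Qed.

Section Renewal.
Variables (R : realFieldType) (d : nat) (p : 'I_d -> R).

Definition level_prob n : R := expect p n (fun s => (level s)%:R).
Definition never_prob n : R := expect p n (fun s => (never_level s)%:R).

(** The expectation of [last_level]: what precedes the last level time and what follows it are
    independent, so each term factors. *)
Lemma last_level_decomposition N :
  \sum_(n < N.+1) level_prob n * never_prob (N - n) = 1.
Proof.
rewrite -(expect1 _ _ p N).
transitivity (expect p N (fun s : seq {ffun 'I_d -> bool} =>
   \sum_(n < N.+1) (level (take n s))%:R * (never_level (drop n s))%:R)).
  rewrite expect_sum; apply: eq_bigr => n _.
  rewrite -expect_cat subnKC //; exact: ltn_ord n.
apply: eq_expect => s sN.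
rewrite -[RHS](_ : (1%N)%:R = 1) // -(last_level _ _ _ sN) natr_sum.
by apply: eq_bigr => n _; rewrite -natrM mulnb.
Qed.

End Renewal.

Arguments level_prob {R d} p n.
Arguments never_prob {R d} p n.

(** * The binomial mass function *)

Definition binom_mass (R : realFieldType) (p : R) (n k : nat) : R :=
  'C(n, k)%:R * p ^+ k * (1 - p) ^+ (n - k).

Definition binom_mean (R : realFieldType) (p : R) (n : nat) (f : nat -> R) : R :=
  \sum_(k < n.+1) binom_mass R p n k * f k.

Arguments binom_mass {R} p n k.
Arguments binom_mean {R} p n f.

Section Binomial.
Variables (R : realFieldType) (p : R).

Lemma binom_mass_gt n k : (n < k)%N -> binom_mass p n k = 0.
Proof. by move=> nk; rewrite /binom_mass bin_small // !mul0r. Qed.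

Lemma binom_massS n k :
  binom_mass p n.+1 k.+1 = p * binom_mass p n k + (1 - p) * binom_mass p n k.+1.
Proof.
rewrite /binom_mass binS natrD subSS.
case: (ltnP k n) => kn.
  have -> : (n - k = (n - k.+1).+1)%N by lia.
  by rewrite !exprS; ring.
have -> : 'C(n, k.+1) = 0%N by apply: bin_small.
by rewrite exprS; ring.
Qed.

(** Conditioning on a single trial; this matches the recursion of [expect] and drives the inductions
    on [n]. *)
Lemma binom_meanS n f : binom_mean p n.+1 f =
  p * binom_mean p n (fun k => f k.+1) + (1 - p) * binom_mean p n f.
Proof.
rewrite /binom_mean big_ord_recl /=.
rewrite (eq_bigr (fun k : 'I_n.+1 => p * (binom_mass p n k * f k.+1) +
   (1 - p) * (binom_mass p n k.+1 * f k.+1))); last first.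
  by move=> k _; rewrite /bump /= add1n binom_massS; ring.
rewrite big_split /= addrCA -!mulr_sumr; congr (_ + _).
rewrite [X in _ + _ * X]big_ord_recr /= (binom_mass_gt n n.+1) // mul0r addr0.
rewrite [in RHS]big_ord_recl /= mulrDr; congr (_ + _).
by rewrite /binom_mass !bin0 !subn0 exprS; ring.
Qed.

Lemma binom_mean_delta n m : binom_mean p n (fun k => (k == m)%:R) = binom_mass p n m.
Proof.
case: (leqP m n) => mn; last first.
  rewrite binom_mass_gt // /binom_mean big1 // => k _.
  have := ltn_ord k; case: eqP => [|_ _]; last by rewrite mulr0.
  lia.
rewrite /binom_mean (bigD1 (Ordinal (mn : (m < n.+1)%N))) //= eqxx mulr1 big1 ?addr0 // => k.
by rewrite -val_eqE /= => /negbTE ->; rewrite mulr0.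
Qed.

Lemma sum_binom_mass n : \sum_(k < n.+1) binom_mass p n k = 1.
Proof.
transitivity (binom_mean p n (fun=> 1)).
  by apply: eq_bigr => k _; rewrite mulr1.
elim: n => [|n IH]; last by rewrite binom_meanS IH; ring.
by rewrite /binom_mean big_ord_recr big_ord0 /binom_mass /= bin0 !expr0; ring.
Qed.

Lemma binom_variance n :
  binom_mean p n (fun k => (k%:R - n%:R * p) ^+ 2) = n%:R * (p * (1 - p)).
Proof.
elim: n => [|n IH].
  by rewrite /binom_mean big_ord_recr big_ord0 /binom_mass /= bin0 !expr0; ring.
have -> : n.+1%:R * (p * (1 - p)) = n%:R * (p * (1 - p)) + p * (1 - p).
  by rewrite -natr1; ring.
rewrite binom_meanS -IH.
have -> : p * (1 - p) = \sum_(k < n.+1) p * (1 - p) * binom_mass p n k.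
  by rewrite -mulr_sumr sum_binom_mass mulr1.
rewrite /binom_mean !mulr_sumr -!big_split /=.
by apply: eq_bigr => k _; rewrite -!natr1; ring.
Qed.

(** Both ['C(n, k)] and ['C(n, k.+1)] are multiples of ['C(n.+1, k.+1)] by absorption ([E1], [E2]).
    The increment thus becomes a mass times a deviation from the mean, which the variance
    controls. *)
Lemma binom_mass_diff n k : p != 0 -> p != 1 ->
  binom_mass p n k.+1 - binom_mass p n k =
  binom_mass p n.+1 k.+1 * (n.+1%:R * p - k.+1%:R) / (p * (1 - p) * n.+1%:R).
Proof.
move=> p0 p1; have q0 : 1 - p != 0 by rewrite subr_eq0 eq_sym.
have n0 : n.+1%:R != 0 :> R by rewrite pnatr_eq0.
case: (ltnP n k) => kn; first by rewrite !binom_mass_gt ?subrr ?mul0r //; lia.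
apply: (canRL (mulfK _)); first by rewrite !mulf_neq0.
have E1 : k.+1%:R * 'C(n.+1, k.+1)%:R = n.+1%:R * 'C(n, k)%:R :> R.
  by rewrite -!natrM mul_bin_diag.
have E2 : n.+1%:R * 'C(n, k.+1)%:R = (n%:R - k%:R) * 'C(n.+1, k.+1)%:R :> R.
  by rewrite -natrB // -!natrM; congr _%:R; rewrite mul_bin_down subSS.
have -> : binom_mass p n.+1 k.+1 * (n.+1%:R * p - k.+1%:R) =
   p ^+ k.+1 * (1 - p) ^+ (n - k) *
     (p * (n.+1%:R * 'C(n.+1, k.+1)%:R) - k.+1%:R * 'C(n.+1, k.+1)%:R).
  by rewrite /binom_mass subSS; ring.
have E3 : k.+1%:R = k%:R + 1 :> R by rewrite natr1.
have E4 : n.+1%:R = n%:R + 1 :> R by rewrite natr1.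
have -> : (binom_mass p n k.+1 - binom_mass p n k) * (p * (1 - p) * n.+1%:R) =
  p ^+ k.+1 * (1 - p) ^+ (n - k) *
   (p * (n.+1%:R * 'C(n, k.+1)%:R) - (1 - p) * (n.+1%:R * 'C(n, k)%:R)).
  (* At [k = n] the exponent [n - k.+1] is truncated, but its coefficient ['C(n, k.+1)] vanishes. *)
  rewrite /binom_mass; case: (ltnP k n) => kn'.
    have -> : (n - k = (n - k.+1).+1)%N by lia.
    by rewrite !exprS; ring.
  have -> : 'C(n, k.+1) = 0%N by apply: bin_small.
  by rewrite exprS; ring.
congr (_ * _); rewrite -E1 E2 E3 E4; ring.
Qed.

Hypothesis hp : 0 < p < 1.

Lemma binom_mass_ge0 n k : 0 <= binom_mass p n k.
Proof.
by rewrite /binom_mass !mulr_ge0 ?exprn_ge0 //; have := hp; lra.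
Qed.

Lemma binom_mass_le1 n k : binom_mass p n k <= 1.
Proof.
case: (leqP k n) => kn; last by rewrite binom_mass_gt.
rewrite -(sum_binom_mass n) (bigD1 (Ordinal (kn : (k < n.+1)%N))) //= lerDl.
by apply: sumr_ge0 => i _; apply: binom_mass_ge0.
Qed.

(** Chebyshev's inequality: where the indicator is 1, the squared deviation is at least [s ^+ 2]. *)
Lemma binom_tail n (s : R) : 0 < s ->
  binom_mean p n (fun k => (s <= `|k%:R - n%:R * p|)%R%:R) <= n%:R * (p * (1 - p)) / s ^+ 2.
Proof.
move=> s0; rewrite -binom_variance /binom_mean mulr_suml; apply: ler_sum => k _.
rewrite -mulrA ler_wpM2l ?binom_mass_ge0 //.
case: (leP s) => /= h; last by rewrite mulr0n divr_ge0 ?sqr_ge0.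
by rewrite mulr1n ler_pdivlMr ?exprn_gt0 // mul1r -[leRHS]real_normK ?num_real // lerXn2r ?nnegrE ?(ltW s0).
Qed.

End Binomial.

(* The oscillation of the mass function is at most the mean deviation of the next one,
   which Chebyshev--Cauchy--Schwarz controls; a mass function vanishing at infinity is
   bounded by its oscillation. *)
Lemma binom_mass_local (R : rcfType) (p : R) n k : 0 < p < 1 ->
  binom_mass p n k <= (Num.sqrt (p * (1 - p) * n.+1%:R))^-1.
Proof.
move=> hp; set v := p * (1 - p) * n.+1%:R; set s := Num.sqrt v.
have v0 : 0 < v by rewrite !mulr_gt0 ?ltr0n //; lra.
have s0 : 0 < s by rewrite sqrtr_gt0.
have ss : s ^+ 2 = v by rewrite sqr_sqrtr // ltW.
have p0 : p != 0 by lra.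
have p1 : p != 1 by lra.
pose dev (j : nat) : R := `|j%:R - n.+1%:R * p|.
have step j : binom_mass p n j.+1 - binom_mass p n j <= binom_mass p n.+1 j.+1 * (dev j.+1 / v).
  rewrite binom_mass_diff // -mulrA ler_wpM2l ?binom_mass_ge0 //.
  by rewrite ler_pM2r ?invr_gt0 // /dev distrC ler_norm.
(* The increment from the value 0 at index -1; here the bound is an equality. *)
have start : binom_mass p n 0 <= binom_mass p n.+1 0 * (dev 0%N / v).
  have -> : dev 0%N = n.+1%:R * p.
    by rewrite /dev sub0r normrN ger0_norm // mulr_ge0 //; lra.
  rewrite le_eqVlt; apply/orP; left; apply/eqP.
  have : n.+1%:R != 0 :> R by rewrite pnatr_eq0.
  rewrite /binom_mass !bin0 !subn0 (exprS _ n) /v; move: n.+1%:R => N N0; field.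
  by rewrite N0 p0 subr_eq0 eq_sym p1.
have sum_bound m : binom_mass p n m <= \sum_(j < m.+1) binom_mass p n.+1 j * (dev j / v).
  elim: m => [|m IH]; first by rewrite big_ord_recl big_ord0 addr0.
  by rewrite big_ord_recr /=; have := step m; lra.
have [kn|nk] := leqP k n; last by rewrite binom_mass_gt // invr_ge0 ltW.
have ext : \sum_(j < k.+1) binom_mass p n.+1 j * (dev j / v) <=
           \sum_(j < n.+2) binom_mass p n.+1 j * (dev j / v).
  rewrite (big_ord_widen n.+2 (fun j => binom_mass p n.+1 j * (dev j / v))); last by lia.
  rewrite [leRHS](bigID (fun j : 'I_ _ => (j < k.+1)%N)) /= lerDl.
  apply: sumr_ge0 => j _; apply: mulr_ge0; first exact: binom_mass_ge0.
  by rewrite divr_ge0 ?(ltW v0) ?normr_ge0.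
apply: (le_trans (sum_bound k)); apply: (le_trans ext).
(* AM-GM: [2 s |x| <= s^2 + x^2] *)
have amgm j : binom_mass p n.+1 j * (dev j / v) <= binom_mass p n.+1 j *
    ((2 * s)^-1 + (j%:R - n.+1%:R * p) ^+ 2 / (2 * s * v)).
  rewrite ler_wpM2l ?binom_mass_ge0 // -[X in X / (2 * s * v)]real_normK ?num_real // -/(dev j).
  have -> : (2 * s)^-1 + dev j ^+ 2 / (2 * s * v) = (v + dev j ^+ 2) / (2 * s * v).
    by field; rewrite !gt_eqF.
  have -> : dev j / v = (2 * s * dev j) / (2 * s * v).
    by field; rewrite !gt_eqF.
  have d0 : 0 < 2 * s * v by apply: mulr_gt0 => //; apply: mulr_gt0.
  rewrite ler_pM2r ?invr_gt0 // -ss.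
  by have := sqr_ge0 (s - dev j); nra.
apply: le_trans; first by apply: ler_sum => j _; exact: amgm.
under eq_bigr => j _ do rewrite mulrDr mulrA.
rewrite big_split /= -!mulr_suml sum_binom_mass.
have := @binom_variance _ p n.+1; rewrite /binom_mean => ->.
have -> : n.+1%:R * (p * (1 - p)) = v by rewrite mulrC.
suff -> : 1 / (2 * s) + v / (2 * s * v) = s^-1 by [].
by field; rewrite !gt_eqF.
Qed.

(** * The joint law of the column counts *)

Section LevelProb.
Variables (R : realFieldType) (d : nat) (p : 'I_d -> R).

(** The counts are independent binomial variables, tested on products. In the induction the first
    row shifts the argument of each [f j]. *)
Lemma expect_column_count n (f : 'I_d -> nat -> R) :
  expect p n (fun s => \prod_j f j (column_count s j)) =
  \prod_j binom_mean (p j) n (f j).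
Proof.
elim: n f => [|n IH] f /=.
  apply: eq_bigr => j _; rewrite /binom_mean big_ord_recr big_ord0 /binom_mass /= bin0 !expr0.
  by rewrite /column_count /=; ring.
under eq_bigr => c _ do rewrite (IH (fun j k => f j (c j + k)%N)).
rewrite (row_weight_prod _ _ _ (fun j b => binom_mean (p j) n (fun k => f j (b + k)%N))).
by apply: eq_bigr => j _; rewrite binom_meanS.
Qed.

Lemma level_prob_sum n : (0 < d)%N ->
  level_prob p n = \sum_(k < n.+1) \prod_j binom_mass (p j) n k.
Proof.
move=> d0; pose j0 := Ordinal d0.
rewrite /level_prob.
(* Split according to the common value [k] of the counts; only [k] equal to the count of column [j0]
   can contribute. *)
transitivity (expect p n (fun s : seq {ffun 'I_d -> bool} =>
   \sum_(k < n.+1) \prod_j (column_count s j == k)%:R)).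
  apply: eq_expect => s sn.
  have cn : (column_count s j0 < n.+1)%N by rewrite ltnS -sn count_size.
  rewrite (bigD1 (Ordinal cn)) //= [X in _ + X]big1 ?addr0; last first.
    move=> k; rewrite -val_eqE /= => kj; apply/eqP/prodf_eq0.
    by exists j0 => //; move: kj; rewrite eq_sym => /negbTE ->.
  case: (boolP (level s)) => [/forallP h|].
    by rewrite big1 // => j _; have /forallP/(_ j0) -> := h j.
  move=> /forallPn[i /forallPn[j ij]]; apply/esym/eqP/prodf_eq0.
  case: (eqVneq (column_count s i) (column_count s j0)) => [e|ne].
    by exists j => //; move: ij; rewrite e eq_sym => /negbTE ->.
  by exists i => //; rewrite (negbTE ne).
rewrite expect_sum; apply: eq_bigr => k _.
rewrite (expect_column_count n (fun j m => (m == k)%:R)).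
by apply: eq_bigr => j _; rewrite binom_mean_delta.
Qed.

End LevelProb.

(** * Estimates for the rencontre probabilities *)

Definition bhattacharyya (R : rcfType) (x y : R) : R :=
  Num.sqrt (x * y) + Num.sqrt ((1 - x) * (1 - y)).

Arguments bhattacharyya {R} x y.

(** The equality case is kept because it yields the strict inequality in [bhattacharyya_lt1]. *)
Lemma sqrt_amgm (R : rcfType) (x y : R) : 0 <= x -> 0 <= y ->
  Num.sqrt (x * y) <= (x + y) / 2 ?= iff (x == y).
Proof.
move=> x0 y0; have s0 := sqrtr_ge0 (x * y).
have m0 : 0 <= (x + y) / 2 by lra.
have E : ((x + y) / 2) ^+ 2 - Num.sqrt (x * y) ^+ 2 = ((x - y) / 2) ^+ 2.
  by rewrite sqr_sqrtr ?mulr_ge0 //; field.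
split.
  by rewrite -ler_sqr ?nnegrE // -subr_ge0 E sqr_ge0.
rewrite -(@eqrXn2 _ 2) // eq_sym -subr_eq0 E sqrf_eq0 mulf_eq0 subr_eq0.
by rewrite invr_eq0 pnatr_eq0 orbF.
Qed.

Lemma bhattacharyya_ge0 (R : rcfType) (x y : R) : 0 <= bhattacharyya x y.
Proof. by rewrite addr_ge0 ?sqrtr_ge0. Qed.

Lemma bhattacharyya_le1 (R : rcfType) (x y : R) : 0 < x < 1 -> 0 < y < 1 ->
  bhattacharyya x y <= 1.
Proof.
move=> x01 y01; have [||a _] := @sqrt_amgm R x y; [lra..|].
have [||b _] := @sqrt_amgm R (1 - x) (1 - y); [lra..|].
by rewrite /bhattacharyya; lra.
Qed.

Lemma bhattacharyya_lt1 (R : rcfType) (x y : R) : 0 < x < 1 -> 0 < y < 1 ->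
  x != y -> bhattacharyya x y < 1.
Proof.
move=> x01 y01 xy.
have [||b _] := @sqrt_amgm R (1 - x) (1 - y); [lra..|].
have [||a ea] := @sqrt_amgm R x y; [lra..|].
have {}a : Num.sqrt (x * y) < (x + y) / 2 by rewrite lt_neqAle ea xy.
by rewrite /bhattacharyya; lra.
Qed.

Section LevelBounds.
Variables (R : rcfType) (d : nat) (p : 'I_d -> R).
Hypothesis hp : forall j, 0 < p j < 1.

Lemma level_prob_ge0 n : 0 <= level_prob p n.
Proof.
rewrite -[leLHS](mul0r (expect p n (fun=> 1))) -expectZ.
by apply: ler_expect => // s _; rewrite mul0r ler0n.
Qed.

(* Dropping factors bounds the probability of a rencontre by the Bhattacharyya
   coefficient of the laws of S^i(n) and S^j(n). *)
Lemma level_prob_geometric i j n : i != j ->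
  level_prob p n <= bhattacharyya (p i) (p j) ^+ n.
Proof.
move=> ij; have hi := hp i; have hj := hp j.
have ab1 : bhattacharyya (p i) (p j) <= 1 by apply: bhattacharyya_le1.
move: ab1; rewrite /bhattacharyya; set a := Num.sqrt _; set b := Num.sqrt (_ * _) => ab1.
have a0 : 0 <= a by apply: sqrtr_ge0.
have b0 : 0 <= b by apply: sqrtr_ge0.
have aa : a ^+ 2 = p i * p j by rewrite sqr_sqrtr // mulr_ge0; lra.
have bb : b ^+ 2 = (1 - p i) * (1 - p j) by rewrite sqr_sqrtr // mulr_ge0; lra.
have d0 : (0 < d)%N by apply: leq_ltn_trans (ltn_ord i).
rewrite level_prob_sum //.
(* [t k] is the geometric mean of the two binomial masses at [k]. By the binomial theorem these sum
   to [(a + b) ^+ n <= 1], so each is at most 1 and [t k ^+ 2 <= t k]. *)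
pose t (k : nat) : R := 'C(n, k)%:R * a ^+ k * b ^+ (n - k).
have t0 k : 0 <= t k by rewrite /t !mulr_ge0 ?exprn_ge0.
have sumt : \sum_(k < n.+1) t k = (a + b) ^+ n.
  rewrite [a + b]addrC exprDn; apply: eq_bigr => k _.
  by rewrite /t -[RHS]mulr_natl; ring.
have t1 (k : 'I_n.+1) : t k <= 1.
  apply: (@le_trans _ _ ((a + b) ^+ n)); last by rewrite exprn_ile1 // addr_ge0.
  rewrite -sumt (bigD1 k) //= lerDl; exact: sumr_ge0.
rewrite -sumt; apply: ler_sum => k _.
apply: (@le_trans _ _ (t k ^+ 2)); last by rewrite expr2 ler_piMr.
have -> : t k ^+ 2 = binom_mass (p i) n k * binom_mass (p j) n k.
  rewrite /t !exprMn -!exprM ![(_ * 2)%N]mulnC !exprM aa bb !exprMn /binom_mass.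
  ring.
rewrite (bigD1 i) //= (bigD1 j) 1?eq_sym //= mulrA ler_piMr //.
  by rewrite mulr_ge0 ?binom_mass_ge0.
by apply: prodr_ile1 => l _; rewrite binom_mass_ge0 ?binom_mass_le1.
Qed.

Lemma level_prob_summable_neq i j : p i != p j ->
  exists U, forall N, \sum_(n < N) level_prob p n <= U.
Proof.
move=> pij; have ij : i != j by apply: contraNneq pij => ->.
set r := bhattacharyya (p i) (p j).
have r0 : 0 <= r by apply: bhattacharyya_ge0.
have r1 : r < 1 by apply: bhattacharyya_lt1.
exists (1 - r)^-1 => N.
apply: (@le_trans _ _ (\sum_(n < N) r ^+ n)).
  by apply: ler_sum => n _; apply: level_prob_geometric.
have r1' : 0 < 1 - r by lra.
rewrite -[leRHS]mul1r ler_pdivlMr // mulrC.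
have -> : (1 - r) * \sum_(n < N) r ^+ n = 1 - r ^+ N.
  by rewrite -[RHS]opprB subrX1 -mulNr opprB.
by have := exprn_ge0 N r0; lra.
Qed.

(** Four of the [d] equal factors are kept: three are bounded by [binom_mass_local], the fourth sums
    to 1 over [k]. *)
Lemma level_prob_local q n : (4 <= d)%N -> (forall j, p j = q) ->
  level_prob p n <= (Num.sqrt (q * (1 - q) * n.+1%:R))^-1 ^+ 3.
Proof.
move=> d4 pq; have d0 : (0 < d)%N by lia.
have hq : 0 < q < 1 by rewrite -(pq (Ordinal d0)).
rewrite level_prob_sum //; set M := _ ^-1.
have -> : M ^+ 3 = \sum_(k < n.+1) M ^+ 3 * binom_mass q n k.
  by rewrite -mulr_sumr sum_binom_mass mulr1.
apply: ler_sum => k _.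
rewrite (eq_bigr (fun=> binom_mass q n k)); last by move=> j _; rewrite pq.
rewrite prodr_const card_ord.
apply: (@le_trans _ _ (binom_mass q n k ^+ 4)).
  by rewrite ler_wiXn2l ?binom_mass_ge0 ?binom_mass_le1.
rewrite exprSr ler_wpM2r ?binom_mass_ge0 // lerXn2r ?nnegrE ?binom_mass_ge0 //.
  by rewrite invr_ge0 sqrtr_ge0.
exact: binom_mass_local.
Qed.

Lemma level_prob_summable_eq q : (4 <= d)%N -> (forall j, p j = q) ->
  exists U, forall N, \sum_(n < N) level_prob p n <= U.
Proof.
move=> d4 pq; have d0 : (0 < d)%N by lia.
have hq : 0 < q < 1 by rewrite -(pq (Ordinal d0)).
set v := Num.sqrt (q * (1 - q)).
have v0 : 0 < v by rewrite sqrtr_gt0 mulr_gt0; lra.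
pose s n : R := Num.sqrt n.+1%:R.
have s0 n : 0 < s n by rewrite sqrtr_gt0 ltr0n.
have ss n : s n ^+ 2 = n.+1%:R by rewrite sqr_sqrtr ?ler0n.
exists (v^-1 ^+ 3 * 3) => N.
apply: (@le_trans _ _ (\sum_(n < N) v^-1 ^+ 3 * (s n)^-1 ^+ 3)).
  apply: ler_sum => n _; rewrite -exprMn -invfM -sqrtrM; last by rewrite mulr_ge0; lra.
  exact: level_prob_local.
rewrite -mulr_sumr ler_wpM2l ?exprn_ge0 ?invr_ge0 ?(ltW v0) //.
(* Comparison with the integral of [x^(-3/2)]; the constant 3 makes the case [n = 0] an equality. *)
have telescope n : \sum_(k < n.+1) (s k)^-1 ^+ 3 <= 3 - 2 / s n.
  elim: n => [|n IH].
    by rewrite big_ord_recr big_ord0 /= /s sqrtr1 invr1; lra.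
  rewrite big_ord_recr /=; apply: (le_trans (lerD IH (lexx _))).
  have s0n := s0 n; have s0n1 := s0 n.+1.
  have hs : s n.+1 ^+ 2 = s n ^+ 2 + 1 by rewrite !ss -[n.+2%:R]natr1.
  have := invr_gt0 (s n); have := invr_gt0 (s n.+1); rewrite s0n s0n1.
  move: (s n) (s n.+1) s0n s0n1 hs => x y x0 y0 hs yi0 xi0.
  (* Since [y ^+ 2 - x ^+ 2 = 1], the difference [2 / x - 2 / y] equals [2 / (x * y * (x + y))],
     which is at least [y^-1 ^+ 3] because [x <= y]. *)
  have lexy : x <= y by nra.
  suff : y^-1 ^+ 3 <= 2 / x - 2 / y by lra.
  have -> : 2 / x - 2 / y = 2 / (x * y * (x + y)).
    have -> : 2 / x - 2 / y = 2 * (y ^+ 2 - x ^+ 2) / (x * y * (x + y)).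
      by field; rewrite !gt_eqF ?addr_gt0.
    by rewrite hs addrAC subrr add0r mulr1.
  rewrite -[leLHS]mul1r ler_pdivlMr ?mulr_gt0 ?addr_gt0 //.
  rewrite mul1r exprVn mulrC ler_pdivrMr ?exprn_gt0 //.
  have : x * y * (x + y) <= y * y * (y + y).
    by rewrite ler_pM ?mulr_ge0 ?addr_ge0 ?ler_wpM2r ?lerD2r // ltW.
  by rewrite !exprS; lra.
case: N => [|N]; first by rewrite big_ord0.
apply: (le_trans (telescope N)).
by rewrite gerBl divr_ge0 ?(ltW (s0 N)).
Qed.

End LevelBounds.

(** * The lower bound for three equal parameters *)

Lemma card_window a b N : (\sum_(k < N) ((a <= k) && (k < b)) <= b - a)%N.
Proof.
(* Strengthened for the induction on [N]: the window is cut off at [N]. *)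
suff : (\sum_(k < N) ((a <= k) && (k < b)) <= minn b N - a)%N by lia.
elim: N => [|N IH]; first by rewrite big_ord0.
rewrite big_ord_recr /=; apply: (leq_trans (leq_add IH (leqnn _))).
by case: leqP => /=; case: ltnP => /=; lia.
Qed.

(* By Chebyshev a window of width of order [sqrt n] carries mass 3/4, where [b^3 >= 3
   t^2 b - 2 t^3]; [t] is of the order of the mean mass in the window. *)
Lemma sum_binom_mass_cube (R : archiRcfType) (q : R) n : 0 < q < 1 ->
  (64 * n.+1%:R)^-1 <= \sum_(k < n.+2) binom_mass q n.+1 k ^+ 3.
Proof.
move=> hq; set m : R := n.+1%:R; set r := Num.sqrt m.
have m1 : 1 <= m by rewrite ler1n.
have rr : r ^+ 2 = m by rewrite sqr_sqrtr //; lra.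
have r1 : 1 <= r by rewrite -sqrtr1 ler_wsqrtr.
have r0 : 0 < r by lra.
have mq0 : 0 < m * q by rewrite mulr_gt0; lra.
(* The window [[a, b)] contains every natural number within distance [r] of the mean; [a] is 0 when
   [m * q - r] is negative. *)
set a := Num.truncn (m * q - r); set b := (Num.truncn (m * q + r)).+1.
pose w (k : nat) : R := ((a <= k) && (k < b))%N%:R.
have w1 k : w k <= 1 by rewrite /w; case: (_ && _).
have w0 k : 0 <= w k by rewrite /w ler0n.
(* Rounding costs at most 2, and [2 * r + 2 <= 4 * r] since [1 <= r]. *)
have width : \sum_(k < n.+2) w k <= 4 * r.
  rewrite -natr_sum; apply: (@le_trans _ _ (b - a)%N%:R).
    by rewrite ler_nat card_window.
  have ha : m * q - r < a.+1%:R by apply: truncnS_gt.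
  have hb : (Num.truncn (m * q + r))%:R <= m * q + r by rewrite truncn_le; lra.
  case: (leqP a b) => ab; last by rewrite (_ : (b - a = 0)%N) ?mulr0n; [lra | lia].
  by move: ha; rewrite natrB // /b -!natr1; lra.
have mass : 3 / 4 <= \sum_(k < n.+2) w k * binom_mass q n.+1 k.
  have tail := @binom_tail R q hq n.+1 r r0.
  (* As [r ^+ 2 = m], the Chebyshev bound is [q * (1 - q)], at most 1/4. *)
  have : n.+1%:R * (q * (1 - q)) / r ^+ 2 <= 4^-1.
    rewrite rr mulrAC divff ?mul1r; last by lra.
    by have := sqr_ge0 (q - 2^-1); nra.
  move=> /(le_trans tail); rewrite /binom_mean => {}tail.
  have := sum_binom_mass R q n.+1.
  suff : \sum_(k < n.+2) binom_mass q n.+1 k <=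
     \sum_(k < n.+2) binom_mass q n.+1 k * (r <= `|k%:R - n.+1%:R * q|)%R%:R +
     \sum_(k < n.+2) w k * binom_mass q n.+1 k by lra.
  rewrite -big_split /=; apply: ler_sum => k _.
  have b0 := @binom_mass_ge0 R q hq n.+1 k.
  case: (leP r) => hk; first by rewrite mulr1 lerDl mulr_ge0.
  rewrite mulr0 add0r /w.
  move: hk; rewrite -/m ltr_norml => /andP[h1 h2].
  have -> : (a <= k)%N.
    rewrite -ltnS -(ltr_nat R).
    case: (leP 0 (m * q - r)) => h.
      by have := truncn_le (m * q - r); rewrite h -/a -natr1; lra.
    by rewrite /a truncn_floor leNgt h /= ltr0n.
  have -> : (k < b)%N by rewrite ltnS truncn_ge_nat; lra.
  by rewrite mul1r.
(* With mass at least 3/4 and width at most [4 * r], this [t] gives at least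
   [9/4 * t ^+ 2 - t ^+ 2], more than [t ^+ 2 = (64 * m)^-1]. *)
set t : R := (8 * r)^-1.
have t0 : 0 < t by rewrite invr_gt0; lra.
have tr : t * r = 8^-1 by rewrite /t; field; lra.
apply: (@le_trans _ _ (\sum_(k < n.+2) w k * (3 * t ^+ 2 * binom_mass q n.+1 k - 2 * t ^+ 3))); last first.
  apply: ler_sum => k _; have := @binom_mass_ge0 R q hq n.+1 k.
  move: (binom_mass _ _ _) => x x0.
  (* The cube lies above its tangent at [t] on the nonnegative axis. *)
  have x3 : 3 * t ^+ 2 * x - 2 * t ^+ 3 <= x ^+ 3.
    rewrite -subr_ge0.
    have -> : x ^+ 3 - (3 * t ^+ 2 * x - 2 * t ^+ 3) = (x - t) ^+ 2 * (x + 2 * t) by ring.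
    by rewrite mulr_ge0 ?sqr_ge0 //; lra.
  apply: (le_trans (ler_wpM2l (w0 k) x3)).
  by rewrite ler_piMl ?exprn_ge0.
have -> : \sum_(k < n.+2) w k * (3 * t ^+ 2 * binom_mass q n.+1 k - 2 * t ^+ 3) =
  3 * t ^+ 2 * (\sum_(k < n.+2) w k * binom_mass q n.+1 k) - 2 * t ^+ 3 * \sum_(k < n.+2) w k.
  rewrite !mulr_sumr -sumrB; apply: eq_bigr => k _; ring.
have -> : (64 * m)^-1 = t ^+ 2 by rewrite -rr /t; field; lra.
have t2 : 0 < t ^+ 2 by apply: exprn_gt0.
have E : 2 * t ^+ 3 * (4 * r) = t ^+ 2.
  have -> : 2 * t ^+ 3 * (4 * r) = 8 * (t * r) * t ^+ 2 by ring.
  by rewrite tr; field.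
have : 2 * t ^+ 3 * (\sum_(k < n.+2) w k) <= t ^+ 2.
  by rewrite -[leRHS]E ler_wpM2l // mulr_ge0 ?exprn_ge0 // ltW.
by have := ler_wpM2l (ltW t2) mass; lra.
Qed.

Lemma level_prob_cube (R : archiRcfType) (p : 'I_3 -> R) q n :
  0 < q < 1 -> (forall j, p j = q) -> (64 * n.+1%:R)^-1 <= level_prob p n.+1.
Proof.
move=> hq pq; rewrite level_prob_sum //.
apply: le_trans (sum_binom_mass_cube _ q n hq) _; apply: ler_sum => k _.
rewrite (eq_bigr (fun=> binom_mass q n.+1 k)); last by move=> j _; rewrite pq.
by rewrite prodr_const card_ord.
Qed.

(** * The law of the trials *)

Lemma measure_fibers (d0 : measure_display) (T : measurableType d0) (R : realType)
  (P : probability T R) (C : finType) (f : T -> C) (A : set T) :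
  (forall c, measurable (A `&` f @^-1` [set c])) ->
  P A = (\sum_c P (A `&` f @^-1` [set c]))%E.
Proof.
move=> mA.
have {1}-> : A = \bigcup_(c in [set: C]) (A `&` f @^-1` [set c]).
  by apply/seteqP; split => [w Aw|w [c _ [Aw _]]//]; exists (f w).
rewrite measure_fin_bigcup //=; last first.
  by move=> a b _ _ [w [[_ wa] [_ wb]]]; rewrite -wa -wb.
rewrite (@fsbig_seq _ _ _ _ (index_enum C)) ?index_enum_uniq //.
by apply: eq_fsbigl; apply/seteqP; split => // c _ /=; apply: mem_index_enum.
Qed.

Lemma measure_eq_off_null (d0 : measure_display) (T : measurableType d0) (R : realType)
  (P : probability T R) (A B N : set T) :
  measurable A -> measurable B -> measurable N -> P N = 0%E ->
  (forall w, ~ N w -> (A w <-> B w)) -> P A = P B.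
Proof.
move=> mA mB mN N0 AB; rewrite -(measureU0 mA mN N0) -(measureU0 mB mN N0).
congr (P _); apply/seteqP; split => w /=; case: (pselect (N w)) => Nw; try by right.
  by case => // /(AB w Nw); left.
by case => // /(AB w Nw); left.
Qed.

Section History.
Variables (d0 : measure_display) (T : measurableType d0) (R : realType).
Variables (P : probability T R) (d : nat) (p : 'I_d -> R) (X : 'I_d -> nat -> T -> R).
Hypothesis hXm : forall j k, measurable_fun setT (X j k).
Hypothesis hXb : forall j k, P (X j k @^-1` [set 1]) = (p j)%:E /\
                     P (X j k @^-1` [set 0]) = (1 - p j)%:E.
Hypothesis hind : mutually_independent P (fun jk : 'I_d * nat => X jk.1 jk.2).

(** Every value other than 1 counts as a failure, so the outcome is defined at every [w]; values
    outside 0 and 1 occur only on the null set [non_bernoulli]. *)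
Definition outcome k (w : T) : {ffun 'I_d -> bool} := [ffun j => X j k w == 1].
Definition history n (w : T) := mkseq (fun k => outcome k w) n.

Let mpre j k (B : set R) : measurable B -> measurable (X j k @^-1` B).
Proof. by move=> mB; rewrite -[_ @^-1` _]setTI; apply: hXm. Qed.

Definition cell (b : bool) : set R := if b then [set 1] else ~` [set 1].

Let mcell b : measurable (cell b).
Proof.
rewrite /cell; case: b; first exact: measurable_set1.
by apply: measurableC; exact: measurable_set1.
Qed.

Lemma cellE b x : cell b x <-> (x == 1) = b.
Proof.
case: b; split => /=.
- by move/eqP.
- by move/eqP.
- by move/eqP/negbTE.
- by move/negbT/eqP.
Qed.

Lemma measurable_outcome k c : measurable (outcome k @^-1` [set c]).
Proof.
have -> : outcome k @^-1` [set c] = \bigcap_(j in [set: 'I_d]) (X j k @^-1` cell (c j)).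
  apply/seteqP; split => w /= => [<- j _|h]; first by apply/cellE; rewrite ffunE.
  by apply/ffunP => j; rewrite ffunE; apply/cellE; apply: h.
by apply: fin_bigcap_measurable => // j _; apply: mpre.
Qed.

Lemma measurable_history n (G : pred (seq {ffun 'I_d -> bool})) :
  measurable [set w | G (history n w)].
Proof.
elim: n G => [|n IH] G.
  have -> : [set w | G (history 0 w)] = if G [::] then setT else set0.
    by apply/seteqP; split => w /=; rewrite /history /=; case: (G _).
  by case: (G _); [exact: measurableT | exact: measurable0].
have -> : [set w | G (history n.+1 w)] =
  \bigcup_(c in [set: {ffun 'I_d -> bool}])
    ([set w | G (rcons (history n w) c)] `&` outcome n @^-1` [set c]).
  apply/seteqP; split => w /=; rewrite /history mkseqS.
    by move=> Gw; exists (outcome n w).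
  by case=> c _ [/= Gw ->].
apply: fin_bigcup_measurable => // c _; apply: measurableI; last exact: measurable_outcome.
exact: (IH (fun s => G (rcons s c))).
Qed.

Lemma measurable_history_eq n s : measurable [set w | history n w = s].
Proof.
rewrite (_ : [set _ | _] = [set w | pred1 s (history n w)]); first exact: measurable_history.
by apply/seteqP; split => w /= /eqP.
Qed.

Lemma probability_cell j k b : P (X j k @^-1` cell b) = (if b then p j else 1 - p j)%:E.
Proof.
case: b => /=; first by case: (hXb j k).
rewrite -preimage_setC probability_setC; last by apply: mpre; apply: measurable_set1.
by rewrite (hXb j k).1.
Qed.

Lemma history_law s :
  P [set w | history (size s) w = s] = (\prod_(c <- s) row_weight p c)%:E.
Proof.
pose c0 : {ffun 'I_d -> bool} := [ffun=> false].
(* All trials before time [size s], listed time by time so that the product regroups into row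
   weights. *)
pose F := [seq (j, k) | k <- iota 0 (size s), j <- index_enum 'I_d].
pose B (jk : 'I_d * nat) := cell (nth c0 s jk.2 jk.1).
have uF : uniq F.
  by apply: allpairs_uniq; rewrite ?iota_uniq ?index_enum_uniq // => -[a b] [a' b'] _ _ [-> ->].
have -> : [set w | history (size s) w = s] = \big[setI/setT]_(i <- F) (X i.1 i.2 @^-1` B i).
  rewrite -(bigcap_seq F (fun i => X i.1 i.2 @^-1` B i)); apply/seteqP; split => w /=.
    move=> ws [j k] /allpairsP[[k' j'] /= [kn _ [-> ->]]]; rewrite /B /=.
    apply/cellE; rewrite -{}ws.
    by move: kn; rewrite mem_iota /= add0n => kn; rewrite nth_mkseq // ffunE.
  move=> h; apply: (@eq_from_nth _ c0); rewrite size_mkseq // => k kn.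
  rewrite nth_mkseq //; apply/ffunP => j; rewrite ffunE; apply/cellE.
  apply: (h (j, k)); apply/allpairsP; exists (k, j) => /=.
  by rewrite mem_iota mem_index_enum.
rewrite hind //; last by move=> i; apply: mcell.
rewrite (eq_bigr (fun i => (if nth c0 s i.2 i.1 then p i.1 else 1 - p i.1)%:E)); last first.
  by move=> i _; exact: probability_cell.
rewrite prodEFin big_allpairs_dep /=; congr (_%:E).
by rewrite (big_nth c0) /index_iota subn0.
Qed.

(** The form of [history_event] that admits induction: the first rows are fixed to [s], and the
    event is split by the next outcome, which extends [s]. *)
Lemma history_event_prefix m s (G : pred (seq {ffun 'I_d -> bool})) :
  P ([set w | history (size s) w = s] `&` [set w | G (history (size s + m) w)]) =
  (\prod_(c <- s) row_weight p c * expect p m (fun r => (G (s ++ r))%:R))%:E.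
Proof.
elim: m s => [|m IH] s.
  rewrite addn0 /= cats0; case: (boolP (G s)) => Gs.
    rewrite mulr1 -history_law; congr (P _); apply/seteqP; split => w /=; first by case.
    by move=> ws; split => //; rewrite ws.
  rewrite mulr0 (_ : _ `&` _ = set0) ?measure0 //; apply/seteqP; split => // w /= [-> ].
  exact/negP.
have slice c : [set w | history (size s) w = s] `&` [set w | G (history (size s + m.+1) w)]
    `&` outcome (size s) @^-1` [set c] =
  [set w | history (size (rcons s c)) w = rcons s c] `&`
  [set w | G (history (size (rcons s c) + m) w)].
  rewrite size_rcons addSnnS; apply/seteqP; split => w /=; rewrite /history mkseqS.
    by case=> -[-> Gw] ->.
  by case=> /rcons_inj[ws wc] Gw.
rewrite (measure_fibers _ _ _ P _ (outcome (size s))); last first.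
  move=> c; rewrite slice.
  by apply: measurableI; [exact: measurable_history_eq | exact: measurable_history].
etransitivity; first by apply: eq_bigr => c _; rewrite slice; exact: IH.
rewrite sumEFin /= mulr_sumr; congr (_%:E); apply: eq_bigr => c _.
rewrite -cats1 big_cat /= big_seq1 -mulrA; congr (_ * (_ * _)).
by apply: eq_expect => r _; rewrite -catA.
Qed.

Lemma history_event n (G : pred (seq {ffun 'I_d -> bool})) :
  P [set w | G (history n w)] = (expect p n (fun s => (G s)%:R))%:E.
Proof.
have := history_event_prefix n [::] G; rewrite big_nil mul1r /= => <-.
by congr (P _); apply/seteqP; split => w //= [].
Qed.

End History.

Arguments history {d0 T R d} X n w.

(** * Rencontres as events of the history *)

Section Rencontre.
Variables (d0 : measure_display) (T : measurableType d0) (R : realType).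
Variables (P : probability T R) (d : nat) (p : 'I_d -> R) (X : 'I_d -> nat -> T -> R).
Hypothesis hXm : forall j k, measurable_fun setT (X j k).
Hypothesis hXb : forall j k, P (X j k @^-1` [set 1]) = (p j)%:E /\
                     P (X j k @^-1` [set 0]) = (1 - p j)%:E.
Hypothesis hind : mutually_independent P (fun jk : 'I_d * nat => X jk.1 jk.2).

(** The exceptional set is written as a union over [nat] by enumerating the pairs [(j, k)], so that
    countable subadditivity applies. *)
Definition non_bernoulli : set T :=
  \bigcup_i if unpickle i is Some jk then X jk.1 jk.2 @^-1` ~` ([set 0] `|` [set 1])
            else set0.

Let mpre j k (B : set R) : measurable B -> measurable (X j k @^-1` B).
Proof. by move=> mB; rewrite -[_ @^-1` _]setTI; apply: hXm. Qed.

Lemma measurable_non_bernoulli : measurable non_bernoulli.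
Proof.
apply: bigcupT_measurable => i; case: unpickle => [jk|]; last exact: measurable0.
by apply/mpre/measurableC/measurableU; exact: measurable_set1.
Qed.

Lemma non_bernoulli0 : P non_bernoulli = 0%E.
Proof.
apply: measure_negligible; first exact: measurable_non_bernoulli.
apply: negligible_bigcup => i; case: unpickle => [[j k]|]; last exact: negligible_set0.
have m01 : measurable ([set 0] `|` [set 1] : set R).
  by apply: measurableU; exact: measurable_set1.
apply/negligibleP; first by apply/mpre/measurableC.
have [h1 h0] := hXb j k.
have : P (X j k @^-1` ([set 0] `|` [set 1])) = 1%E.
  transitivity ((1 - p j)%:E + (p j)%:E)%E; last by rewrite -EFinD subrK.
  rewrite -h0 -h1 preimage_setU; apply: measureU; [exact: mpre..|].
  apply/seteqP; split => // w /= [-> /eqP].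
  by rewrite eq_sym oner_eq0.
move=> P1; transitivity (1 - P (X j k @^-1` ([set 0%R] `|` [set 1%R])))%E.
  by apply: probability_setC; apply: mpre.
by rewrite P1 subee.
Qed.

Lemma bernoulli_values w : ~ non_bernoulli w -> forall j k, X j k w = 0 \/ X j k w = 1.
Proof.
move=> nw j k; apply: contrapT => h; apply: nw; exists (pickle (j, k)) => //.
by rewrite pickleK.
Qed.

Lemma S_column_count w n j : ~ non_bernoulli w ->
  S X j n w = (column_count (history X n w) j)%:R.
Proof.
move=> nw; elim: n => [|n IH]; first by rewrite /S big_ord0.
have -> : S X j n.+1 w = S X j n w + X j n w by rewrite /S big_ord_recr.
rewrite IH /history mkseqS -cats1 column_count_cat natrD; congr (_ + _).
rewrite /column_count /= ffunE addn0.
by case: (bernoulli_values w nw j n) => ->; rewrite ?eqxx // eq_sym oner_eq0.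
Qed.

Lemma rencontre_level w n : ~ non_bernoulli w ->
  rencontre X n w <-> level (history X n w).
Proof.
move=> nw; split => [h|/forallP h i j].
  apply/forallP => i; apply/forallP => j.
  by rewrite -(eqr_nat R) -!S_column_count //; apply/eqP; apply: h.
have /forallP/(_ j)/eqP e := h i.
by rewrite !S_column_count // e.
Qed.

Lemma measurable_rencontre n : measurable (rencontre X n).
Proof.
have mS j : measurable_fun setT (S X j n) by apply: measurable_sum => k.
have -> : rencontre X n = \bigcap_(ij in [set: 'I_d * 'I_d])
    [set w | S X ij.1 n w == S X ij.2 n w].
  apply/seteqP; split => w /= => [h [i j] _ /=|h i j]; first by apply/eqP; apply: h.
  by apply/eqP; apply: (h (i, j)).
apply: fin_bigcap_measurable => // -[i j] _ /=.
have := measurable_realfun.measurable_fun_eqr (mS i) (mS j) measurableT (I : measurable [set true]).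
by rewrite setTI; congr measurable; apply/seteqP; split => w /=; rewrite /preimage /= => ->.
Qed.

Lemma probability_rencontre n : P (rencontre X n) = (level_prob p n)%:E.
Proof.
rewrite /level_prob -(history_event _ _ _ P _ _ X) //.
apply: measure_eq_off_null (rencontre_level ^~ n) => //.
- exact: measurable_rencontre.
- exact: measurable_history.
- exact: measurable_non_bernoulli.
- exact: non_bernoulli0.
Qed.

Definition no_rencontre n : set T :=
  \bigcap_(m in [set m | (1 <= m <= n)%N]) ~` rencontre X m.

Lemma measurable_no_rencontre n : measurable (no_rencontre n).
Proof.
by apply: bigcap_measurableType => m _; apply/measurableC/measurable_rencontre.
Qed.

Lemma probability_no_rencontre n : P (no_rencontre n) = (never_prob p n)%:E.
Proof.
rewrite /never_prob -(history_event _ _ _ P _ _ X) //.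
apply: (measure_eq_off_null _ _ _ _ _ _ non_bernoulli).
- exact: measurable_no_rencontre.
- exact: measurable_history.
- exact: measurable_non_bernoulli.
- exact: non_bernoulli0.
move=> w nw; rewrite /= /never_level.
have -> : size (history X n w) = n by rewrite size_mkseq.
have tk m : (m <= n)%N -> take m (history X n w) = history X m w.
  by move=> mn; rewrite /history /mkseq -map_take take_iota; congr (map _ (iota _ _)); lia.
split => [h|/= /allP h m /= /andP[m1 mn]].
  apply/allP => m; rewrite mem_iota add1n ltnS => /andP[m1 mn].
  rewrite tk //; apply/negP => /(rencontre_level _ _ nw); apply: h; exact/andP.
move=> /(rencontre_level _ _ nw); apply/negP; rewrite -tk //; apply: h.
by rewrite mem_iota add1n ltnS m1.
Qed.

(** An infimum of finite values is [+oo] only over the empty set. *)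
Lemma J_infinite : [set w | J X w = +oo%E] = \bigcap_n no_rencontre n.
Proof.
apply/seteqP; split => w /=.
  move=> /ereal_inf_pinfty h n _ m /= /andP[m1 _] rm.
  have : [set +oo%E] (m%:R%:E : \bar R) by apply: h; exists m.
  by [].
move=> h; apply/ereal_inf_pinfty => x [n /= [n1 rn] _].
by case: (h n I n) => //=; rewrite n1 leqnn.
Qed.

(** Continuity from above of [P] along the decreasing events [no_rencontre X n]. *)
Lemma never_prob_cvg :
  (never_prob p n)%:E @[n --> \oo] --> P [set w | J X w = +oo%E].
Proof.
rewrite J_infinite.
have -> : (fun n => (never_prob p n)%:E) = P \o no_rencontre.
  by apply/funext => n /=; rewrite probability_no_rencontre.
apply: nonincreasing_cvg_mu.
- by change (P (no_rencontre 0) < +oo)%E; rewrite probability_no_rencontre ltry.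
- exact: measurable_no_rencontre.
- by apply: bigcapT_measurable => n; exact: measurable_no_rencontre.
move=> m n mn; apply/subsetPset => w h i /= /andP[i1 im]; apply: h => /=.
by rewrite i1 (leq_trans im).
Qed.

End Rencontre.

Arguments no_rencontre {d0 T R d} X n.

(** * Power series and the renewal equation *)

Section PowerSeries.
Variables (R : realType) (u : nat -> R).
Hypothesis u0 : forall n, 0 <= u n.

Definition power_series (x : R) : \bar R := (\sum_(1 <= n <oo) (u n * x ^+ n)%:E)%E.

(** The truncated series is a polynomial, continuous at 1 with value above [A] there; the omitted
    terms are nonnegative. *)
Lemma power_series_lower A N : A < \sum_(1 <= n < N) u n ->
  \forall x \near 1^'-, (A%:E <= power_series x)%E.
Proof.
move=> AN; pose g := \sum_(1 <= n < N) u n *: 'X^n.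
have gE x : g.[x] = \sum_(1 <= n < N) u n * x ^+ n.
  by rewrite /g horner_sum; apply: eq_bigr => n _; rewrite hornerZ hornerXn.
have g1 : A < g.[1] by rewrite gE; under eq_bigr do rewrite expr1n mulr1.
have cg : g.[x] @[x --> 1^'-] --> g.[1] by apply/cvg_at_left_filter/continuous_horner.
have gA : \forall x \near 1^'-, A < g.[x] by apply: cvgr_gt cg _ g1.
near=> x; apply: (@le_trans _ _ (g.[x])%:E); first by rewrite lee_fin ltW //; near: x.
rewrite gE -sumEFin; apply: nneseries_lim_ge => n _ _.
rewrite lee_fin mulr_ge0 ?exprn_ge0 //.
by near: x; apply: nbhs_left_ge; exact: ltr01.
Unshelve. all: by end_near. Qed.

Lemma power_series_upper U x : (forall N, \sum_(1 <= n < N) u n <= U) ->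
  0 <= x <= 1 -> (power_series x <= U%:E)%E.
Proof.
move=> uU /andP[x0 x1]; apply: lime_le.
  by apply: is_cvg_nneseries => n _ _; rewrite lee_fin mulr_ge0 ?exprn_ge0.
near=> N; rewrite sumEFin lee_fin; apply: le_trans (uU N).
by apply: ler_sum => n _; rewrite ler_piMr ?exprn_ile1.
Unshelve. all: by end_near. Qed.

(** Abel's theorem for nonnegative coefficients: the limit is the sum of [u], which bounds the
    series from above, while [power_series_lower] bounds it from below. *)
Lemma power_series_cvg U : (forall N, \sum_(1 <= n < N) u n <= U) ->
  exists l : R, power_series x @[x --> 1^'-] --> l%:E.
Proof.
move=> uU; pose s N := \sum_(1 <= n < N) u n.
have sU : has_ubound (range s) by exists U => _ [N _ <-]; exact: uU.
have snd : nondecreasing_seq s.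
  apply/nondecreasing_seqP => -[|N]; first by rewrite /s !big_geq.
  by rewrite /s (big_nat_recr N.+1) //= lerDl.
have cs := nondecreasing_is_cvgn snd sU.
exists (limn s).
have sl N : s N <= limn s by apply: nondecreasing_cvgn_le.
have ps_le x : 0 <= x <= 1 -> (power_series x <= (limn s)%:E)%E.
  by apply: power_series_upper.
have ps_ge0 x : 0 <= x -> (0 <= power_series x)%E.
  by move=> x0; apply: nneseries_ge0 => n _ _; rewrite lee_fin mulr_ge0 ?exprn_ge0.
have left01 : \forall x \near (1 : R)^'-, 0 <= x <= 1.
  near=> x; apply/andP; split; near: x; first by apply: nbhs_left_ge; exact: ltr01.
  exact: nbhs_left_le.
have psE : \forall x \near 1^'-, (fine (power_series x))%:E = power_series x.
  apply: filterS left01 => x x01; apply: fineK.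
  rewrite ge0_fin_numE; last by apply: ps_ge0; case/andP: x01.
  by apply: le_lt_trans (ps_le x x01) _; rewrite ltry.
apply: cvg_trans (near_eq_cvg psE) _.
apply/cvg_EFin; first exact: nearW.
apply/cvgrPdist_le => e e0.
have [N sN] : exists N, limn s - e < s N.
  have /cvgrPdist_lt/(_ e e0)[N _ /(_ N (leqnn N))] := cs.
  by move=> h; exists N; have := le_lt_trans (ler_norm _) h; lra.
have low := power_series_lower _ _ sN.
near=> x.
have x01 : 0 <= x <= 1 by near: x.
have Ex : (fine (power_series x))%:E = power_series x by near: x.
have l1 : limn s - e <= fine (power_series x) by rewrite -lee_fin Ex; near: x.
have l2 : fine (power_series x) <= limn s by rewrite -lee_fin Ex; apply: ps_le.
by rewrite /= ger0_norm; lra.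
Unshelve. all: by end_near. Qed.

Lemma power_series_dvg : (forall A, exists N, A < \sum_(1 <= n < N) u n) ->
  power_series x @[x --> 1^'-] --> +oo%E.
Proof.
move=> uoo; apply/cvgeyPge => A; have [N AN] := uoo A.
exact: power_series_lower AN.
Qed.

End PowerSeries.

Arguments power_series {R} u x.

Section RenewalEquation.
Variables (R : realType) (u q : nat -> R).
Hypotheses (u0 : forall n, 0 <= u n) (q0 : forall n, 0 <= q n <= 1).
Hypothesis renewal : forall N, \sum_(n < N.+1) u n * q (N - n)%N = 1.

(** If [q] tended to 0, the renewal sum split at [K] would fall below 1: the terms from [K] on sum
    to less than 1/2 by the tail of [u], and the earlier ones to at most 1/2 because [q] is small
    there. *)
Lemma renewal_transient U : (forall N, \sum_(n < N) u n <= U) -> ~ (q n @[n --> \oo] --> 0).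
Proof.
move=> uU qc.
have U0 : 0 <= U by have := uU 0%N; rewrite big_ord0.
have cu : cvgn (series u).
  apply: nondecreasing_is_cvgn; last by exists U => _ [N _ <-]; rewrite /series /= big_mkord.
  by apply/nondecreasing_seqP => N; rewrite /series /= big_nat_recr //= lerDl.
have ul N : series u N <= limn (series u).
  apply: nondecreasing_cvgn_le => //.
  by apply/nondecreasing_seqP => m; rewrite /series /= big_nat_recr //= lerDl.
have [K uK] : exists K, limn (series u) - 2^-1 < series u K.
  have /cvgrPdist_lt/(_ 2^-1)[//|K _ /(_ K (leqnn K))] := cu.
  by move=> h; exists K; have := le_lt_trans (ler_norm _) h; lra.
(* This bound on [q] makes the first [K] terms at most [U / (2 * (U + 1))]; adding 1 keeps the
   divisor positive when [U = 0]. *)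
have e0 : 0 < (2 * (U + 1))^-1 by rewrite invr_gt0; lra.
have [M _ qM] : \forall n \near \oo, q n < (2 * (U + 1))^-1 by apply: cvgr_lt qc _ e0.
have := renewal (K + M); rewrite -(big_mkord xpredT (fun n => u n * q (K + M - n)%N)).
rewrite (@big_cat_nat _ _ _ K) //=; last by lia.
have h1 : \sum_(0 <= n < K) u n * q (K + M - n)%N <= U * (2 * (U + 1))^-1.
  apply: (@le_trans _ _ (\sum_(0 <= n < K) u n * (2 * (U + 1))^-1)).
    rewrite big_nat [leRHS]big_nat; apply: ler_sum => n /andP[_ nK].
    by rewrite ler_wpM2l // ltW // qM //=; lia.
  by rewrite -mulr_suml ler_wpM2r ?(ltW e0) // big_mkord.
have h2 : \sum_(K <= n < (K + M).+1) u n * q (K + M - n)%N < 2^-1.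
  apply: (@le_lt_trans _ _ (\sum_(K <= n < (K + M).+1) u n)).
    by apply: ler_sum => n _; have /andP[_ ?] := q0 (K + M - n)%N; rewrite ler_piMr.
  have := ul (K + M).+1; move: uK; rewrite /series /= (@big_cat_nat _ _ _ K _ (K + M).+1) //=; [lra|lia].
have h3 : U * (2 * (U + 1))^-1 <= 2^-1.
  by rewrite ler_pdivrMr; lra.
by lra.
Qed.

(** Replacing [q] by its lower bound in the renewal equation leaves [l] times the sum of [u], at
    most 1. *)
Lemma renewal_bound l N : 0 < l -> (forall n, l <= q n) -> \sum_(n < N) u n <= l^-1.
Proof.
move=> l0 lq.
case: N => [|N]; first by rewrite big_ord0 invr_ge0 ltW.
rewrite -[leRHS]mul1r ler_pdivlMr // -(renewal N) mulr_suml.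
by apply: ler_sum => n _; rewrite ler_wpM2l.
Qed.

End RenewalEquation.

Lemma harmonic_unbounded (R : realType) (A : R) :
  exists N, A < \sum_(1 <= n < N) (64 * n%:R)^-1.
Proof.
have nd : nondecreasing_seq (series (@harmonic R)).
  by apply/nondecreasing_seqP => N; rewrite /series /= big_nat_recr //= lerDl invr_ge0.
have := nondecreasing_dvgn_lt nd (@dvg_harmonic R).
move=> /cvgryPgt/(_ (64 * A))[N _ /(_ N (leqnn N))]; rewrite /series /= => h.
exists N.+1; rewrite big_add1 /=.
under eq_bigr do rewrite invfM.
by rewrite -mulr_sumr; lra.
Qed.

(** * Transience and recurrence *)

Section Dichotomy.
Variables (d0 : measure_display) (T : measurableType d0) (R : realType).
Variables (P : probability T R) (d : nat) (p : 'I_d -> R) (X : 'I_d -> nat -> T -> R).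
Hypothesis hp : forall j, 0 < p j < 1.
Hypothesis hXm : forall j k, measurable_fun setT (X j k).
Hypothesis hXb : forall j k, P (X j k @^-1` [set 1]) = (p j)%:E /\
                     P (X j k @^-1` [set 0]) = (1 - p j)%:E.
Hypothesis hind : mutually_independent P (fun jk : 'I_d * nat => X jk.1 jk.2).

Let probE n : P (rencontre X n) = (level_prob p n)%:E.
Proof. exact: probability_rencontre. Qed.

Let noE n : P (no_rencontre X n) = (never_prob p n)%:E.
Proof. exact: probability_no_rencontre. Qed.

Lemma phi_power_series : phi P X = power_series (level_prob p).
Proof.
apply/funext => x; rewrite /phi /power_series.
by apply: eq_eseriesr => n _; rewrite probE -EFinM.
Qed.

Lemma never_prob_itv n : 0 <= never_prob p n <= 1.
Proof.
rewrite -!lee_fin -noE measure_ge0 /=.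
by apply: probability_le1; exact: measurable_no_rencontre.
Qed.

Lemma J_infinite_le n : (P [set w | J X w = +oo%E] <= (never_prob p n)%:E)%E.
Proof.
rewrite -noE J_infinite; apply: le_measure; rewrite ?inE.
- by apply: bigcapT_measurable => m; exact: measurable_no_rencontre.
- exact: measurable_no_rencontre.
- by move=> w; apply.
Qed.

(** If [J] were almost surely finite, [never_prob p n] would tend to 0, against
    [renewal_transient]. *)
Lemma transience : (exists U, forall N, \sum_(n < N) level_prob p n <= U) ->
  (exists l : R, phi P X x @[x --> 1^'-] --> l%:E) /\
  (0 < P [set w | J X w = +oo%E])%E.
Proof.
move=> [U uU]; have u0 := level_prob_ge0 _ _ p hp; split.
  rewrite phi_power_series; apply: (power_series_cvg _ _ u0 U) => N.
  case: N => [|N]; first by rewrite big_geq //; have := uU 0%N; rewrite big_ord0.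
  apply: le_trans (uU N.+1).
  by rewrite -(big_mkord xpredT (level_prob p)) [leRHS]big_ltn // lerDr.
rewrite lt0e measure_ge0 andbT; apply/eqP => J0.
apply: (renewal_transient _ _ _ u0 never_prob_itv (last_level_decomposition _ _ p) U uU).
have := never_prob_cvg _ _ _ P d p X hXm hXb hind.
by rewrite J0 => /fine_cvg.
Qed.

(** The probability of [J = +oo] is below every [never_prob p n]; if positive, it would bound the
    partial sums through [renewal_bound]. *)
Lemma recurrence : (forall A, exists N, A < \sum_(1 <= n < N) level_prob p n) ->
  phi P X x @[x --> 1^'-] --> +oo%E /\ P [set w | J X w = +oo%E] = 0%E.
Proof.
move=> uoo; have u0 := level_prob_ge0 _ _ p hp; split.
  by rewrite phi_power_series; apply: power_series_dvg.
apply/eqP; rewrite -measure_le0 leNgt; apply/negP => J0.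
have Jfin : P [set w | J X w = +oo%E] \is a fin_num.
  by rewrite ge0_fin_numE ?measure_ge0 //; apply: le_lt_trans (J_infinite_le 0) (ltry _).
set l := fine (P [set w | J X w = +oo%E]).
have l0 : 0 < l by rewrite -lte_fin fineK.
have lq n : l <= never_prob p n by rewrite -lee_fin fineK //; exact: J_infinite_le.
have [[|N] AN] := uoo l^-1.
  by move: AN; rewrite big_geq // ltNge invr_ge0 ltW.
have := renewal_bound _ _ _ u0 (last_level_decomposition _ _ p) l N.+1 l0 lq.
rewrite -(big_mkord xpredT (level_prob p)) big_ltn //.
by move: AN (u0 0%N); lra.
Qed.

End Dichotomy.

Theorem theorem9 (d0 : measure_display) (T : measurableType d0) (R : realType)
  (P : probability T R) (d : nat) (hd : (3 <= d)%N)
  (p : 'I_d -> R) (hp : forall j, 0 < p j < 1)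
  (X : 'I_d -> nat -> T -> R)
  (hXm : forall j k, measurable_fun setT (X j k))
  (hXb : forall j k, P (X j k @^-1` [set 1]) = (p j)%:E /\
                     P (X j k @^-1` [set 0]) = (1 - p j)%:E)
  (hind : mutually_independent P (fun jk : 'I_d * nat => X jk.1 jk.2)) :
  ((d = 3)%N ->
     ((forall i j, p i = p j) ->
        phi P X x @[x --> at_left 1] --> +oo%E /\
        P [set w | J X w = +oo%E] = 0%E) /\
     (~ (forall i j, p i = p j) ->
        (exists l : R, phi P X x @[x --> at_left 1] --> l%:E) /\
        (0 < P [set w | J X w = +oo%E])%E)) /\
  ((4 <= d)%N ->
     (exists l : R, phi P X x @[x --> at_left 1] --> l%:E) /\
     (0 < P [set w | J X w = +oo%E])%E).
Proof.
have d0' : (0 < d)%N by apply: leq_trans hd.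
have summable_neq : ~ (forall i j, p i = p j) ->
    exists U, forall N, \sum_(n < N) level_prob p n <= U.
  move=> /existsNP[i /existsNP[j /eqP pij]].
  exact: (level_prob_summable_neq _ _ _ hp i j pij).
split => [d3|d4].
  split=> peq; last exact: (transience _ _ _ P d p X hp hXm hXb hind (summable_neq peq)).
  apply: (recurrence _ _ _ P d p X hp hXm hXb hind).
  subst d => A.
  have [N AN] := harmonic_unbounded R A; exists N.
  apply: lt_le_trans AN _; rewrite big_nat [leRHS]big_nat; apply: ler_sum => -[//|n] _.
  by apply: (level_prob_cube _ _ (p ord0)) => // j; exact: peq.
apply: (transience _ _ _ P d p X hp hXm hXb hind).
(* Equal parameters need the local bound and [4 <= d]; unequal ones give a geometric bound. *)
have [peq|pne] := pselect (forall i j, p i = p j); last exact: summable_neq.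
by apply: (level_prob_summable_eq _ _ _ hp (p (Ordinal d0'))) => // j; exact: peq.
Qed.
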